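(* Let $n\ge1$ and $\beta\in(0,\infty)$. (1) Let $d<n/2$. (a) If $\beta>1/2$, then $U_d[\phi]$ possesses the eventual $\beta$-log-concavity property for all $\phi\in\mathcal{L}$. (b) If $\beta<1/2$, then $U_d[\phi]$ does not possess the eventual $\beta$-log-concavity property for any $\phi\in\mathcal{L}$. (2) Let $d=n/2$. (a) If $\beta>1/2$, then $U_d[\phi]$ possesses the eventual $\beta$-log-concavity property for all $\phi\in\mathcal{L}$ with $M_\phi<1$. (b) If $\beta<1/2$, then $U_d[\phi]$ does not possess the eventual $\beta$-log-concavity property for some $\phi\in\mathcal{L}$ with $M_\phi<1$.
   Context: $\mathcal{L}$ is the set of nontrivial (not a.e. zero), nonnegative, bounded measurable functions on $\mathbb{R}^n$ with compact support. For $\phi\in\mathcal{L}$, $M_\phi:=\int_{\mathbb{R}^n}\phi(y)\,dy$, $(e^{t\Delta}\phi)(x):=(4\pi t)^{-n/2}\int_{\mathbb{R}^n}e^{-|x-y|^2/(4t)}\phi(y)\,dy$ and, for $d\in\mathbb{R}$, $U_d[\phi](x,t):=(4\pi t)^d(e^{t\Delta}\phi)(x)$, $(x,t)\in\mathbb{R}^n\times(0,\infty)$. For $\beta\in(0,\infty)$ define $\Psi_\beta:[0,1)\to[-\infty,\infty)$ by $\Psi_\beta(\tau)=-(-\log\tau)^\beta$ for $\tau\in(0,1)$ and $\Psi_\beta(0)=-\infty$. A function $f:\mathbb{R}^n\to[0,1)$ is $\beta$-log-concave in $\mathbb{R}^n$ if $\Psi_\beta(f((1-\mu)x+\mu y))\ge(1-\mu)\Psi_\beta(f(x))+\mu\Psi_\beta(f(y))$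 for all $x,y\in\mathbb{R}^n$, $\mu\in(0,1)$. $U_d[\phi]$ possesses the eventual $\beta$-log-concavity property if there exists $T>0$ such that $U_d[\phi](\cdot,t)$ is ($[0,1)$-valued and) $\beta$-log-concave in $\mathbb{R}^n$ for all $t\in[T,\infty)$. *)

(* Defs.v *)
From HB Require Import structures.
From mathcomp Require Import all_boot all_order all_algebra.
From mathcomp Require Import all_classical all_reals all_analysis.
Import Order.TTheory GRing.Theory Num.Theory.
Import numFieldNormedType.Exports.

Set Implicit Arguments.
Unset Strict Implicit.
Unset Printing Implicit Defensive.

Local Open Scope classical_set_scope.
Local Open Scope ring_scope.

(* Borel sigma-algebra of R^n, as the product sigma-algebra: it is generated
   by the coordinate maps. *)
Definition rV_display : measure_display.
Proof. exact: default_measure_display. Qed.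

Section rV_measurable.
Variables (R : realType) (n : nat).

Let coord (i : 'I_n) (x : 'rV[R]_n) : measurableTypeR R := x ord0 i.

Let rV_set0 : g_sigma_preimage coord set0.
Proof. exact: sigma_algebra0. Qed.

Let rV_setC A : g_sigma_preimage coord A -> g_sigma_preimage coord (~` A).
Proof. exact: sigma_algebraC. Qed.

Let rV_bigcup (F : (set 'rV[R]_n)^nat) :
  (forall i, g_sigma_preimage coord (F i)) ->
  g_sigma_preimage coord (\bigcup_i (F i)).
Proof. exact: sigma_algebra_bigcup. Qed.

HB.instance Definition _ := @isMeasurable.Build rV_display
  'rV[R]_n (g_sigma_preimage coord) rV_set0 rV_setC rV_bigcup.

Lemma measurable_rV_coord (i : 'I_n) :
  measurable_fun [set: 'rV[R]_n] (coord i).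
Proof.
move=> _ Y mY; rewrite setTI; apply: sub_sigma_algebra => /=.
rewrite -bigcup_seq/=; exists i => /=; first by rewrite mem_index_enum.
by exists Y => //; rewrite setTI.
Qed.

Lemma measurable_fun_rV d (T : measurableType d) (f : T -> 'rV[R]_n) :
  (forall i, measurable_fun [set: T] (coord i \o f)) ->
  measurable_fun [set: T] f.
Proof.
move=> mf _ A mA.
suff : g_sigma_preimage (fun i => coord i \o f) (f @^-1` A).
  have /smallest_sub : sigma_algebra [set: T] (@measurable _ T).
    exact: sigma_algebra_measurable.
  move=> H gA; rewrite setTI; move: gA; apply: H.
  rewrite -bigcup_seq => B [i _ [C mC <-]]; exact: mf.
by rewrite g_sigma_preimage_comp; exists A => //; rewrite setTI.
Qed.

End rV_measurable.

Section lebesgue_rV.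
Variable R : realType.

Definition rV_cons n (p : measurableTypeR R * 'rV[R]_n) : 'rV[R]_n.+1 :=
  \row_i oapp (p.2 ord0) p.1 (unlift ord0 i).

Definition rV_uncons n (x : 'rV[R]_n.+1) : measurableTypeR R * 'rV[R]_n :=
  (x ord0 ord0, \row_i x ord0 (lift ord0 i)).

Lemma rV_consK n : cancel (@rV_cons n) (@rV_uncons n).
Proof.
move=> [a x]; rewrite /rV_uncons /rV_cons !mxE unlift_none/=; congr pair.
by apply/rowP => i; rewrite !mxE liftK.
Qed.

Lemma rV_unconsK n : cancel (@rV_uncons n) (@rV_cons n).
Proof.
move=> x; apply/rowP => i; rewrite !mxE.
by case: unliftP => [j|] -> //=; rewrite mxE.
Qed.

Lemma measurable_rV_cons n : measurable_fun setT (@rV_cons n).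
Proof.
apply: measurable_fun_rV => i.
case: (unliftP ord0 i) => [j|] ->.
- rewrite (_ : _ \o _ = (fun x : 'rV[R]_n => x ord0 j : measurableTypeR R) \o snd).
    by apply: measurableT_comp => //; exact: measurable_rV_coord.
  by apply/funext => p /=; rewrite !mxE liftK.
- rewrite (_ : _ \o _ = fst)//.
  by apply/funext => p /=; rewrite !mxE unlift_none.
Qed.

Lemma measurable_rV_uncons n : measurable_fun setT (@rV_uncons n).
Proof.
apply/measurable_fun_pairP; split; first exact: measurable_rV_coord.
apply: measurable_fun_rV => i.
rewrite (_ : _ \o _ = fun x : 'rV[R]_n.+1 => x ord0 (lift ord0 i)).
  exact: measurable_rV_coord.
by apply/funext => x /=; rewrite mxE.
Qed.

HB.instance Definition _ n := isMeasurableFun.Build _ _ _ _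
  (@rV_cons n) (@measurable_rV_cons n).

Section step.
Variables (n : nat) (mu : {sigma_finite_measure set 'rV[R]_n -> \bar R}).

Definition lebesgue_rV_step : set 'rV[R]_n.+1 -> \bar R :=
  pushforward (@lebesgue_measure R \x mu)%E (@rV_cons n).

Let step0 : lebesgue_rV_step set0 = 0%E.
Proof. exact: measure0. Qed.

Let step_ge0 A : (0 <= lebesgue_rV_step A)%E.
Proof. exact: measure_ge0. Qed.

Let step_sigma_additive : semi_sigma_additive lebesgue_rV_step.
Proof. exact: measure_semi_sigma_additive. Qed.

HB.instance Definition _ := isMeasure.Build _ _ _ lebesgue_rV_step
  step0 step_ge0 step_sigma_additive.

Let sigma_finite_step : sigma_finite setT lebesgue_rV_step.
Proof.
have /sigma_finiteP[F [FT ndF Foo]] := sigma_finiteT (@lebesgue_measure R).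
have /sigma_finiteP[G [GT ndG Goo]] := sigma_finiteT mu.
exists (fun k => @rV_uncons n @^-1` (F k `*` G k)).
  rewrite -preimage_bigcup -[LHS](preimage_setT (@rV_uncons n)).
  congr (_ @^-1` _); rewrite -setXTT FT GT; apply/seteqP; split=> -[x y] /=.
    move=> [[k _ Fkx] [l _ Gly]]; exists (maxn k l) => //; split.
    - by move: x Fkx; exact/subsetPset/ndF/leq_maxl.
    - by move: y Gly; exact/subsetPset/ndG/leq_maxr.
  by move=> [k _ []/= ? ?]; split; exists k.
move=> k; have [mF Fk] := Foo k; have [mG Gk] := Goo k; split.
  rewrite -[X in measurable X]setTI; apply: measurable_rV_uncons => //.
  exact: measurableX.
rewrite /lebesgue_rV_step /pushforward -comp_preimage.
rewrite (_ : _ \o _ = id); last by apply/funext => p /=; rewrite rV_consK.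
by rewrite preimage_id product_measure1E// lte_mul_pinfty// ge0_fin_numE.
Qed.

HB.instance Definition _ := Measure_isSigmaFinite.Build _ _ _
  lebesgue_rV_step sigma_finite_step.

End step.

(* Borel Lebesgue measure on R^n: the n-fold product of the Lebesgue measure
   on R. *)
Fixpoint borel_lebesgue_rV n : {sigma_finite_measure set 'rV[R]_n -> \bar R} :=
  match n with
  | 0%N => (\d_(0 : 'rV[R]_0))%R
  | m.+1 => lebesgue_rV_step (borel_lebesgue_rV m)
  end.

Lemma borel_lebesgue_rV_box n (A : 'I_n -> set (measurableTypeR R)) :
  (forall i, measurable (A i)) ->
  borel_lebesgue_rV n [set x | forall i, A i (x ord0 i)] =
  (\prod_(i < n) lebesgue_measure (A i))%E.
Proof.
elim: n A => [|n IH] A mA.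
  rewrite big_ord0 /= diracE mem_set//= => -[]//.
have mbox : measurable [set x : 'rV[R]_n | forall i, A (lift ord0 i) (x ord0 i)].
  rewrite (_ : mkset _ = \bigcap_(i in [set: 'I_n])
      ((fun x : 'rV[R]_n => x ord0 i) @^-1` A (lift ord0 i))).
    apply: fin_bigcap_measurable; first exact: finite_finset.
    move=> i _; rewrite -[X in measurable X]setTI.
    exact: measurable_rV_coord.
  by apply/seteqP; split=> x /= h i => [_|]; exact: h.
rewrite big_ord_recl -IH// -product_measure1E//=.
rewrite /lebesgue_rV_step /pushforward; congr (_ _).
apply/seteqP; split=> -[a x] /=.
- move=> h; split; first by have := h ord0; rewrite !mxE unlift_none.
  by move=> i; have := h (lift ord0 i); rewrite !mxE liftK.
- move=> [ha hx] i; rewrite !mxE.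
  by case: (unliftP ord0 i) => [j|] ->; [exact: hx|].
Qed.

Definition lebesgue_rV_type n : measurableType _ :=
  caratheodory_type ((borel_lebesgue_rV n)^*)%mu.

(* Lebesgue measure on R^n, the completion of the Borel one: the measurable
   sets of lebesgue_rV_type n are the Lebesgue measurable subsets of R^n. *)
Definition lebesgue_rV n : set (lebesgue_rV_type n) -> \bar R :=
  @completed_measure_extension _ _ _ (borel_lebesgue_rV n).

HB.instance Definition _ n := Measure.on (@lebesgue_rV n).

Let sigma_finite_lebesgue_rV n : sigma_finite setT (@lebesgue_rV n).
Proof. exact/completed_measure_extension_sigma_finite/sigma_finiteT. Qed.

HB.instance Definition _ n := Measure_isSigmaFinite.Build _ _ _
  (@lebesgue_rV n) (@sigma_finite_lebesgue_rV n).

Lemma measurable_lebesgue_rV n (A : set 'rV[R]_n) :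
  measurable A -> measurable (A : set (lebesgue_rV_type n)).
Proof. by move=> mA; apply: sub_caratheodory; exact: sub_sigma_algebra. Qed.

Lemma lebesgue_rVE n (A : set 'rV[R]_n) : measurable A ->
  lebesgue_rV A = borel_lebesgue_rV n A.
Proof. by move=> mA; rewrite /lebesgue_rV /completed_measure_extension measurable_mu_extE. Qed.

End lebesgue_rV.

Section heat.
Variables (R : realType) (n : nat).
Implicit Types (phi f : 'rV[R]_n -> R) (x y : 'rV[R]_n).

Local Notation leb := (@lebesgue_rV R n).

Definition classL phi : Prop :=
  [/\ measurable_fun [set: lebesgue_rV_type R n] phi,
      forall y, 0 <= phi y,
      [bounded phi y | y in [set: 'rV[R]_n]],
      compact (closure [set y | phi y != 0]) &
      ~ {ae leb, forall y, phi y = 0}].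

Definition mass phi : R := \int[leb]_y phi y.

(* `|x - y| is the sup norm on 'rV[R]_n, whence the explicit sum. *)
Definition sqdist x y : R := \sum_(i < n) (x ord0 i - y ord0 i) ^+ 2.

Definition heat (t : R) phi x : R :=
  (4 * pi * t) `^ (- (n%:R / 2)) *
  \int[leb]_y (expR (- (sqdist x y / (4 * t))) * phi y).

Definition Ud (d : R) phi x (t : R) : R := (4 * pi * t) `^ d * heat t phi x.

(* Psi is only applied to tau in [0, 1): log_concave requires f to take its
   values there. *)
Definition Psi (beta tau : R) : \bar R :=
  if tau == 0 then -oo%E else (- ((- ln tau) `^ beta))%:E.

Definition log_concave (beta : R) f : Prop :=
  (forall x, 0 <= f x < 1) /\
  forall x y (mu : R), 0 < mu < 1 ->
    ((1 - mu)%R%:E * Psi beta (f x) + mu%:E * Psi beta (f y)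
       <= Psi beta (f ((1 - mu) *: x + mu *: y)%R))%E.

Definition eventually_log_concave (beta d : R) phi : Prop :=
  exists T : R, 0 < T /\
    forall t, T <= t -> log_concave beta (fun x => Ud d phi x t).

End heat.

(* Main.v *)
Require Import Defs.
From mathcomp Require Import all_boot all_order all_algebra ring lra.
From mathcomp Require Import all_classical all_reals all_analysis.
From mathcomp Require Import measurable_realfun.
Import Order.TTheory GRing.Theory Num.Theory.
Import numFieldNormedType.Exports.
Local Open Scope classical_set_scope.
Local Open Scope ring_scope.

Set Implicit Arguments.
Unset Strict Implicit.
Unset Printing Implicit Defensive.

(* Write V = - ln U_d[phi](., t), so that beta-log-concavity means that V is
   positive and V^beta is convex. Up to an additive constant V(x) is |x|^2/(4t)
   minus a log-Laplace transform of the compactly supported phi, hence V(x) grows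
   like |x|^2/(4t).

   If beta > 1/2, a sub-Gaussian bound for the measures exp(-|x-y|^2/(4t)) phi(y) dy
   gives V(x + s r) >= V(x) + s p + a s^2 |r|^2 with a close to 1/(4t). Since
   beta (1 - beta) < 1/4, for large t one has a |r|^2 V(x) >= beta (1 - beta) p^2 for
   all x; the one-variable inequality powR_support then turns the quadratic minorant
   of V into a supporting line of V^beta at x.

   If beta < 1/2, V^beta grows sublinearly along rays, so were it convex it would be
   bounded on rays, whereas V is not; this holds for every t > 0. *)

(** * Elementary inequalities for exponentials and real powers *)

Lemma expR_convex (R : realType) (a b x y : R) : 0 <= a -> 0 <= b -> a + b = 1 ->
  expR (a * x + b * y) <= a * expR x + b * expR y.
Proof.
move=> a0 b0 ab; set m := a * x + b * y.
have tangent z : expR m * (1 + (z - m)) <= expR z.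
  rewrite (_ : expR z = expR m * expR (z - m)); last by rewrite -expRD addrC subrK.
  by rewrite ler_wpM2l ?expR_ge0// expR_ge1Dx.
have := lerD (ler_wpM2l a0 (tangent x)) (ler_wpM2l b0 (tangent y)).
apply: le_trans; rewrite le_eqVlt; apply/orP; left; apply/eqP.
by rewrite /m (_ : b = 1 - a); [ring | lra].
Qed.

(** The linear term integrates to zero for a centred [z], which leaves a sub-Gaussian bound. For [z]
    between -1/2 and 1/2, [expR z] is at most 1/(1 - z), and (1 - z)(1 + z + 2z^2) - 1 = z^2 (1 -
    2z). *)
Lemma expR_le_sqr (R : realType) (z : R) : expR z <= z + expR (2 * z ^+ 2).
Proof.
have H1 := expR_ge1Dx (2 * z ^+ 2).
have [z1|z1] := leP (2^-1) z.
  suff : expR z <= expR (2 * z ^+ 2) by lra.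
  by rewrite ler_expR; nra.
have [z2|z2] := leP z (- 2^-1).
  suff : expR z <= 1 by nra.
  by rewrite -expR0 ler_expR; lra.
have hN := expR_ge1Dx (- z); have ez := expR_gt0 z.
have e1 : expR z * expR (- z) = 1 by rewrite -expRD subrr expR0.
have : expR z * (1 - z) <= 1.
  by rewrite -[leRHS]e1 ler_wpM2l ?expR_ge0.
suff : 0 <= (1 - z) * (z + (1 + 2 * z ^+ 2)) - 1 by nra.
rewrite (_ : _ - 1 = z ^+ 2 * (1 - 2 * z)); last by ring.
by apply: mulr_ge0; [exact: sqr_ge0 | lra].
Qed.

(** Since q = (2 - q) * 1 + (q - 1) * 2, the power y^q is a weighted geometric mean of y and y^2;
    convexity of exp in the variable ln y bounds it by the arithmetic mean. *)
Lemma powR_young12 (R : realType) (y q : R) : 0 <= y -> 1 <= q <= 2 ->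
  y `^ q <= (2 - q) * y + (q - 1) * y ^+ 2.
Proof.
rewrite le_eqVlt => /predU1P[<-|y0] /andP[q1 q2].
  by rewrite powR0 ?gt_eqF//; lra.
have ey : expR (ln y) = y by rewrite lnK.
rewrite -ey -expRM -expRM_natl.
rewrite (_ : _ * q = (2 - q) * ln y + (q - 1) * (2 * ln y)); last by ring.
by apply: expR_convex; lra.
Qed.

(** Convexity of exp at the points 0 and b ln z, with weights 1 - 1/b and 1/b. *)
Lemma powR_bernoulli (R : realType) (z b : R) : 0 <= z -> 1 <= b ->
  1 + b * (z - 1) <= z `^ b.
Proof.
rewrite le_eqVlt => /predU1P[<-|z0] b1.
  by rewrite powR0 ?gt_eqF//; lra.
have b0 : 0 < b by lra.
have bV : b * b^-1 = 1 by rewrite divff ?gt_eqF.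
have ez : expR (ln z) = z by rewrite lnK.
have := @expR_convex R (1 - b^-1) b^-1 0 (b * ln z).
rewrite (_ : _ * 0 + _ = (b * b^-1) * ln z); last by ring.
rewrite bV mul1r ez expR0 mulr1 (mulrC b) expRM ez => H.
have /H : 0 <= 1 - b^-1 by rewrite subr_ge0 invf_le1.
rewrite invr_ge0 (ltW b0) subrK => /(_ erefl erefl).
by rewrite -(ler_pM2l b0) mulrDr mulrBr mulrA bV; lra.
Qed.

(* For [b < 1] the bound on [theta] is sharp: there the claim is, up to the
   substitution [y = 1 + b u], the inequality [powR_young12] with [q = 1 / b]. *)
Lemma powR_support (R : realType) (b theta u z : R) :
  1 / 2 < b -> 0 <= theta -> b * (1 - b) <= theta -> 0 <= z ->
  1 + u + theta * u ^+ 2 <= z -> 1 + b * u <= z `^ b.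
Proof.
move=> b12 th0 hth z0 hz.
have [b1|b1] := leP 1 b.
  apply: le_trans (powR_bernoulli z0 b1); rewrite lerD2l ler_wpM2l; nra.
have [neg|pos] := leP (1 + b * u) 0; first exact: le_trans (powR_ge0 _ _).
have b0 : 0 < b by lra.
have iq : b * b^-1 = 1 by rewrite divff ?gt_eqF.
have -> : 1 + b * u = ((1 + b * u) `^ b^-1) `^ b.
  by rewrite -powRrM mulVf ?gt_eqF// powRr1// ltW.
apply: ge0_ler_powR; rewrite ?nnegrE ?(ltW b0) ?powR_ge0//.
apply: le_trans (powR_young12 (ltW pos) _) (le_trans _ hz).
  by rewrite invf_ge1// (ltW b1)/= -(ler_pM2l b0) iq; lra.
rewrite [leLHS](_ : _ = 1 + (b * b^-1) * u + b * (b * b^-1 - b) * u ^+ 2).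
  by rewrite iq; have := ler_wpM2r (sqr_ge0 u) hth; lra.
by ring.
Qed.

(** * Integrability against functions of the class, and positivity of the mass *)

Section integration.
Variables (R : realType) (n : nat).
Notation leb := (@lebesgue_rV R n).
Notation rV := (lebesgue_rV_type R n).

Lemma measurable_coord (i : 'I_n) :
  measurable_fun [set: rV] (fun y : rV => (y : 'rV[R]_n) ord0 i).
Proof.
move=> _ Y mY; apply: measurable_lebesgue_rV.
exact: (@measurable_rV_coord R n i measurableT Y mY).
Qed.

Lemma measurable_box (a b : R) :
  measurable [set y : 'rV[R]_n | forall i, `[a, b]%classic (y ord0 i)].
Proof.
rewrite (_ : mkset _ = \bigcap_(i in [set: 'I_n])
    ((fun y : 'rV[R]_n => y ord0 i) @^-1` `[a, b]%classic)).
  apply: fin_bigcap_measurable; first exact: finite_finset.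
  move=> i _; rewrite -[X in measurable X]setTI.
  exact: measurable_rV_coord.
by apply/seteqP; split=> y /= h i => [_|]; exact: h.
Qed.

Lemma lebesgue_rV_box (a b : R) : a <= b ->
  leb [set y : 'rV[R]_n | forall i, `[a, b]%classic (y ord0 i)] = ((b - a) ^+ n)%:E.
Proof.
move=> ab; rewrite lebesgue_rVE; last exact: measurable_box.
rewrite (@borel_lebesgue_rV_box R n (fun=> `[a, b]%classic))//.
rewrite (eq_bigr (fun=> (b - a)%:E)); last first.
  move=> i _; rewrite lebesgue_measure_itv/= lte_fin.
  by move: ab; rewrite le_eqVlt => /predU1P[->|->]; rewrite ?ltxx ?subrr.
by rewrite prodEFin prodr_const card_ord.
Qed.

Lemma classL_support (phi : 'rV[R]_n -> R) : classL phi ->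
  exists K : R, 0 <= K /\ forall y, phi y != 0 -> forall i, `|y ord0 i| <= K.
Proof.
move=> [_ _ _ cpt _].
have [M [_ /(_ (`|M| + 1))]] := compact_bounded cpt.
rewrite ltr_pwDr ?ler_norm// => /(_ erefl) bnd.
exists (`|M| + 1); split=> // y phiy i.
have /= := bnd y (@subset_closure 'rV[R]_n [set y | phi y != 0] y phiy).
apply: le_trans; rewrite [leRHS]mx_normrE.
exact: (le_bigmax_cond _ (fun ij : 'I_1 * 'I_n => `|y ij.1 ij.2|) (j := (ord0, i))).
Qed.

(** The product vanishes outside a box of finite measure and is bounded on it. Bounding [f] only
    where [phi] is nonzero admits unbounded factors such as coordinates. *)
Lemma integrable_weight (phi f : 'rV[R]_n -> R) (C : R) : classL phi ->
  measurable_fun [set: rV] f -> (forall y, phi y != 0 -> `|f y| <= C) ->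
  leb.-integrable [set: rV] (EFin \o (fun y => f y * phi y)).
Proof.
move=> Lphi mf fC; have [K [K0 suppK]] := classL_support Lphi.
have [mphi phi0 [M [_ phiMx]] _ _] := Lphi.
have phiM : forall y, `|phi y| <= `|M| + 1.
  by move=> y; apply: phiMx => //; rewrite ltr_pwDr ?ler_norm.
pose B : set rV := [set y : 'rV[R]_n | forall i, `[- K, K]%classic (y ord0 i)].
have mB : measurable B by exact: (measurable_lebesgue_rV (measurable_box (- K) K)).
have muB : (leb B < +oo)%E by rewrite /B lebesgue_rV_box ?ltry//; lra.
have mfphi : measurable_fun [set: rV] (fun y => f y * phi y) by exact: measurable_funM.
have -> : EFin \o (fun y => f y * phi y) = (EFin \o (fun y => f y * phi y)) \_ B.
  apply/funext => y; rewrite patchE; case: ifPn => // /negP yB /=.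
  have [->|phiy] := eqVneq (phi y) 0; first by rewrite mulr0.
  by exfalso; apply: yB; rewrite inE => i /=; rewrite in_itv/= -ler_norml suppK.
apply/(integrable_mkcond _ mB)/measurable_bounded_integrable => //.
- exact: measurable_funS mfphi.
- exists (`|C| * (`|M| + 1)); split; first exact: num_real.
  move=> c hc y _ /=; apply: le_trans (ltW hc); rewrite normrM.
  have [->|phiy] := eqVneq (phi y) 0.
    by rewrite normr0 mulr0 mulr_ge0// addr_ge0.
  apply: ler_pM => //.
  exact: le_trans (fC _ phiy) (ler_norm _).
Qed.

(** A nonnegative function with zero integral vanishes almost everywhere, which nontriviality
    excludes. *)
Lemma mass_gt0 (phi : 'rV[R]_n -> R) : classL phi -> 0 < mass phi.
Proof.
move=> Lphi; have [mphi phi0 _ _ nae] := Lphi.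
have iphi : leb.-integrable [set: rV] (EFin \o phi).
  have := @integrable_weight phi (fun=> 1) 1 Lphi.
  rewrite (_ : (fun y => 1 * phi y) = phi); last by apply/funext => y; rewrite mul1r.
  by apply=> //; move=> y _; rewrite normr1.
rewrite lt_neqAle Rintegral_ge0 ?andbT//.
apply/eqP => m0; apply: nae.
have mE : measurable_fun [set: rV] (EFin \o phi) by exact/measurable_EFinP.
have i0 : (\int[leb]_(y in [set: rV]) `|(EFin \o phi) y| = 0)%E.
  under eq_integral => y _ do rewrite gee0_abs ?lee_fin//.
  by rewrite -(fineK (integrable_fin_num measurableT iphi)); congr (_%:E).
have := (ae_eq_integral_abs leb measurableT mE).1 i0.
by apply: filterS => y /= /(_ I)[].
Qed.

End integration.

(** * Integrals weighted by [phi], and exponential tilting *)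

Section weighted_integral.
Variables (R : realType) (n : nat) (phi : 'rV[R]_n -> R).
Hypothesis Lphi : classL phi.
Notation leb := (@lebesgue_rV R n).
Notation rV := (lebesgue_rV_type R n).
Implicit Types f g w : 'rV[R]_n -> R.

Definition supp_bounded f : Prop := measurable_fun [set: rV] f /\
  exists C, forall y, phi y != 0 -> `|f y| <= C.

Definition wint f : R := \int[leb]_y (f y * phi y).

Lemma supp_bounded_cst c : supp_bounded (fun=> c).
Proof. by split=> //; exists `|c|. Qed.

Lemma supp_bounded_coord (i : 'I_n) : supp_bounded (fun y => y ord0 i).
Proof.
split; first exact: measurable_coord.
by have [K [_ HK]] := classL_support Lphi; exists K => y /HK.
Qed.

Lemma supp_boundedD f g : supp_bounded f -> supp_bounded g ->
  supp_bounded (fun y => f y + g y).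
Proof.
move=> [mf [C fC]] [mg [D gD]]; split; first exact: measurable_funD.
exists (C + D) => y py; apply: le_trans (ler_normD _ _) _.
by rewrite lerD ?fC ?gD.
Qed.

Lemma supp_boundedM f g : supp_bounded f -> supp_bounded g ->
  supp_bounded (fun y => f y * g y).
Proof.
move=> [mf [C fC]] [mg [D gD]]; split; first exact: measurable_funM.
by exists (C * D) => y py; rewrite normrM ler_pM ?fC ?gD.
Qed.

Lemma supp_boundedZ c f : supp_bounded f -> supp_bounded (fun y => c * f y).
Proof. exact/supp_boundedM/supp_bounded_cst. Qed.

Lemma supp_boundedN f : supp_bounded f -> supp_bounded (fun y => - f y).
Proof.
move=> /(supp_boundedZ (-1)); congr supp_bounded.
by apply/funext => y; rewrite mulN1r.
Qed.

Lemma supp_bounded_sum (I : Type) (s : seq I) (F : I -> 'rV[R]_n -> R) :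
  (forall i, supp_bounded (F i)) -> supp_bounded (fun y => \sum_(i <- s) F i y).
Proof.
move=> bF; elim: s => [|i s IH].
  under eq_fun do rewrite big_nil; exact: supp_bounded_cst.
under eq_fun do rewrite big_cons; exact: supp_boundedD.
Qed.

Lemma supp_bounded_expR f : supp_bounded f -> supp_bounded (fun y => expR (f y)).
Proof.
move=> [mf [C fC]]; split; first exact: measurableT_comp.
exists (expR C) => y py; rewrite ger0_norm ?expR_ge0// ler_expR.
exact: le_trans (ler_norm _) (fC _ py).
Qed.

Lemma wint_integrable f : supp_bounded f ->
  leb.-integrable [set: rV] (EFin \o (fun y => f y * phi y)).
Proof. by move=> [mf [C fC]]; exact: integrable_weight fC. Qed.

Lemma wint_le f g : supp_bounded f -> supp_bounded g ->
  (forall y, phi y != 0 -> f y <= g y) -> wint f <= wint g.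
Proof.
move=> bf bg fg; apply: le_Rintegral => //; try exact: wint_integrable.
move=> y _; have [_ phi0 _ _ _] := Lphi.
by have [->|py] := eqVneq (phi y) 0; rewrite ?mulr0// ler_wpM2r// fg.
Qed.

Lemma wintD f g : supp_bounded f -> supp_bounded g ->
  wint (fun y => f y + g y) = wint f + wint g.
Proof.
move=> bf bg; rewrite /wint -RintegralD//; try exact: wint_integrable.
by congr Rintegral; apply/funext => y; rewrite mulrDl.
Qed.

Lemma wintZ c f : supp_bounded f -> wint (fun y => c * f y) = c * wint f.
Proof.
move=> bf; rewrite /wint -RintegralZl//; last exact: wint_integrable.
by congr Rintegral; apply/funext => y; rewrite mulrA.
Qed.

Lemma wint_cst c : wint (fun=> c) = c * mass phi.
Proof.
rewrite -[c in LHS]mulr1 (wintZ c (supp_bounded_cst 1)); congr (_ * _).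
by congr Rintegral; apply/funext => y; rewrite mul1r.
Qed.

(* A two-sided sub-Gaussian bound for the tilted measure [w * phi], which
   replaces the second derivative of the log-Laplace transform. *)
Lemma tilted_mean w l : supp_bounded w -> (forall y, 0 <= w y) -> 0 < wint w ->
  supp_bounded l ->
  exists e, forall c K, (forall y, phi y != 0 -> `|l y - c| <= K) ->
    `|e - c| <= K /\
    forall s, wint (fun y => expR (s * (l y - e)) * w y)
      <= expR (8 * (s * K) ^+ 2) * wint w.
Proof.
(* The witness is the mean of [l] under the normalised measure [w * phi]. It is fixed before [c] and
   [K], so the same mean can be compared with several centres. *)
move=> bw w0 W0 bl; pose e := wint (fun y => l y * w y) / wint w.
have blw := supp_boundedM bl bw.
have eW : e * wint w = wint (fun y => l y * w y) by rewrite mulfVK ?gt_eqF.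
exists e => c K lK.
have eK : `|e - c| <= K.
  have up : wint (fun y => l y * w y) <= wint (fun y => (c + K) * w y).
    apply: wint_le => //; first exact: supp_boundedZ.
    move=> y /lK; rewrite ler_distl => /andP[_ h].
    by rewrite ler_wpM2r.
  have dn : wint (fun y => (c - K) * w y) <= wint (fun y => l y * w y).
    apply: wint_le => //; first exact: supp_boundedZ.
    move=> y /lK; rewrite ler_distl => /andP[h _].
    by rewrite ler_wpM2r.
  move: up dn; rewrite !wintZ// -eW !ler_pM2r// => up dn.
  by rewrite ler_distl dn up.
split=> // s.
have bz : supp_bounded (fun y => s * (l y - e)).
  by apply/supp_boundedZ/supp_boundedD => //; exact: supp_bounded_cst.
(* Apply [expR_le_sqr] to z = s (l - e): as |l - e| <= 2K, the exponent 2z^2 is at most 8 (sK)^2,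
   and the linear term integrates to zero by the choice of [e]. *)
pose E := expR (8 * (s * K) ^+ 2).
apply: (@le_trans _ _ (wint (fun y => s * (l y * w y) + (E - s * e) * w y))).
  apply: wint_le; first exact/supp_boundedM/bw/supp_bounded_expR.
    by apply: supp_boundedD; exact: supp_boundedZ.
  move=> y py; rewrite mulrA -mulrDl ler_wpM2r//.
  apply: le_trans (expR_le_sqr _) _.
  suff : expR (2 * (s * (l y - e)) ^+ 2) <= E by lra.
  rewrite ler_expR !exprMn.
  have : `|l y - e| <= 2 * K.
    rewrite (_ : l y - e = (l y - c) + (c - e)); last by ring.
    apply: le_trans (ler_normD _ _) _; rewrite (distrC c).
    by have := lK _ py; lra.
  have := normr_ge0 (l y - e); rewrite -(real_normK (num_real (l y - e))).
  set q := `|_| => q0 qK; have q2 : q ^+ 2 <= 4 * K ^+ 2 by nra.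
  by have := ler_wpM2l (sqr_ge0 s) q2; lra.
rewrite wintD ?wintZ//; try exact: supp_boundedZ.
rewrite -/E -eW; clearbody e E; rewrite le_eqVlt; apply/orP; left; apply/eqP; ring.
Qed.

End weighted_integral.

(** * Quadratic bounds and quadratic minorants for V = [negln] *)

Lemma cauchy_schwarz_sum (R : realFieldType) (I : finType) (a b : I -> R) :
  (\sum_i a i * b i) ^+ 2 <= (\sum_i a i ^+ 2) * (\sum_i b i ^+ 2).
Proof.
set c := \sum_i a i * b i; set A := \sum_i a i ^+ 2; set B := \sum_i b i ^+ 2.
have A0 : 0 <= A by apply: sumr_ge0 => i _; exact: sqr_ge0.
have : 0 <= B by apply: sumr_ge0 => i _; exact: sqr_ge0.
rewrite le_eqVlt => /predU1P[/esym/eqP|B0].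
  rewrite psumr_eq0 => [/allP b0|i _]; last exact: sqr_ge0.
  suff -> : c = 0 by rewrite expr0n mulr_ge0// sumr_ge0// => i _; exact: sqr_ge0.
  rewrite /c big1// => i _; have := b0 i.
  by rewrite mem_index_enum sqrf_eq0 => /(_ erefl)/eqP->; rewrite mulr0.
have : 0 <= \sum_i (B * a i - c * b i) ^+ 2.
  by apply: sumr_ge0 => i _; exact: sqr_ge0.
have -> : \sum_i (B * a i - c * b i) ^+ 2 = B * (A * B - c ^+ 2).
  rewrite (eq_bigr (fun i => B ^+ 2 * a i ^+ 2 +
    (- (2 * B * c) * (a i * b i) + c ^+ 2 * b i ^+ 2))); last by move=> i _; ring.
  by rewrite !big_split/= -!mulr_sumr -/A -/B -/c; ring.
by rewrite pmulr_rge0// subr_ge0.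
Qed.

Section heat_bounds.
Variables (R : realType) (n : nat) (phi : 'rV[R]_n -> R) (d t Lam : R).
Hypothesis Lphi : classL phi.
Hypothesis t0 : 0 < t.
Hypothesis Lam0 : 0 <= Lam.
Implicit Types x y r : 'rV[R]_n.

Definition dot x y : R := \sum_i x ord0 i * y ord0 i.
Definition sqn x : R := \sum_i x ord0 i ^+ 2.

Hypothesis suppLam : forall y, phi y != 0 -> sqn y <= Lam.

Definition gauss x y : R := expR (- (sqdist x y / (4 * t))).

Definition negln x : R := - ln (Ud d phi x t).

(** The value V would have if the Gaussian factor were replaced by 1. Only this term depends on [d]
    and on the mass. *)
Definition negln_cst : R := (n%:R / 2 - d) * ln (4 * pi * t) - ln (mass phi).

Lemma dot_sqr_le x y : dot x y ^+ 2 <= sqn x * sqn y.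
Proof. exact: cauchy_schwarz_sum. Qed.

Lemma sqn_ge0 x : 0 <= sqn x.
Proof. by apply: sumr_ge0 => i _; exact: sqr_ge0. Qed.

Lemma sqnB x y : sqn (x - y) = sqdist x y.
Proof. by apply: eq_bigr => i _; rewrite !mxE. Qed.

(** Young's inequality with weight [eta]: the coefficient of |x|^2 stays as close to 1 as desired,
    at the cost of a large multiple of |y|^2, which is bounded on the support. *)
Lemma sqdist_ge eta x y : 0 < eta ->
  (1 - eta) * sqn x - sqn y / eta <= sqdist x y.
Proof.
move=> e0; rewrite mulr_sumr mulr_suml -sumrB; apply: ler_sum => i _.
set a := x _ _; set b := y _ _.
have : 0 <= eta^-1 * (eta * a - b) ^+ 2.
  by rewrite mulr_ge0 ?sqr_ge0// invr_ge0 ltW.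
have -> : eta^-1 * (eta * a - b) ^+ 2 = eta * a ^+ 2 - 2 * a * b + b ^+ 2 / eta.
  by field; rewrite gt_eqF.
by have := sqr_ge0 b; lra.
Qed.

Lemma sqdist_le eta x y : 0 < eta ->
  sqdist x y <= (1 + eta) * sqn x + (1 + eta^-1) * sqn y.
Proof.
move=> e0; rewrite !mulr_sumr -big_split/=; apply: ler_sum => i _.
set a := x _ _; set b := y _ _.
have : 0 <= eta^-1 * (eta * a + b) ^+ 2.
  by rewrite mulr_ge0 ?sqr_ge0// invr_ge0 ltW.
have -> : eta^-1 * (eta * a + b) ^+ 2 = eta * a ^+ 2 + 2 * a * b + b ^+ 2 / eta.
  by field; rewrite gt_eqF.
by lra.
Qed.

Lemma supp_bounded_sqdist x : supp_bounded phi (fun y => sqdist x y).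
Proof.
apply: supp_bounded_sum => i.
under eq_fun do rewrite expr2.
by apply: supp_boundedM; apply: supp_boundedD;
  [exact: supp_bounded_cst|exact/supp_boundedN/supp_bounded_coord
  |exact: supp_bounded_cst|exact/supp_boundedN/supp_bounded_coord].
Qed.

Lemma supp_bounded_gauss x : supp_bounded phi (gauss x).
Proof.
apply/supp_bounded_expR/supp_boundedN/supp_boundedM/supp_bounded_cst.
exact: supp_bounded_sqdist.
Qed.

Lemma wint_gauss_ge x :
  expR (- ((2 * sqn x + 2 * Lam) / (4 * t))) * mass phi <= wint phi (gauss x).
Proof.
rewrite -(wint_cst Lphi); apply: wint_le => //; first exact: supp_bounded_cst.
  exact: supp_bounded_gauss.
move=> y /suppLam yL; rewrite ler_expR lerN2 ler_pM2r ?invr_gt0 ?mulr_gt0//.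
by have := @sqdist_le 1 x y ltr01; rewrite invr1; lra.
Qed.

Lemma wint_gauss_le eta x : 0 < eta ->
  wint phi (gauss x) <=
    expR (- (((1 - eta) * sqn x - Lam / eta) / (4 * t))) * mass phi.
Proof.
move=> e0; rewrite -(wint_cst Lphi); apply: wint_le => //.
- exact: supp_bounded_gauss.
- exact: supp_bounded_cst.
move=> y /suppLam yL; rewrite ler_expR lerN2 ler_pM2r ?invr_gt0 ?mulr_gt0//.
apply: le_trans (sqdist_ge x y e0); rewrite lerD2l lerN2.
by rewrite ler_pM2r ?invr_gt0.
Qed.

Lemma wint_gauss_gt0 x : 0 < wint phi (gauss x).
Proof.
by apply: lt_le_trans (wint_gauss_ge x); rewrite mulr_gt0 ?expR_gt0 ?mass_gt0.
Qed.

Lemma fourpit_gt0 : 0 < 4 * pi * t.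
Proof. by rewrite !mulr_gt0 ?pi_gt0. Qed.

Lemma Ud_gt0 x : 0 < Ud d phi x t.
Proof. by rewrite !mulr_gt0 ?powR_gt0 ?fourpit_gt0 ?wint_gauss_gt0. Qed.

Lemma neglnE x :
  negln x = (n%:R / 2 - d) * ln (4 * pi * t) - ln (wint phi (gauss x)).
Proof.
have p0 := fourpit_gt0.
have w0 := wint_gauss_gt0 x.
rewrite /negln /Ud /heat -/(wint phi (gauss x)).
rewrite lnM ?posrE ?mulr_gt0 ?powR_gt0//.
by rewrite (lnM (x := powR _ _)) ?posrE ?powR_gt0// !ln_powR; ring.
Qed.

Lemma negln_ge eta x : 0 < eta ->
  negln_cst + ((1 - eta) * sqn x - Lam / eta) / (4 * t) <= negln x.
Proof.
move=> e0; have := wint_gauss_le x e0; rewrite neglnE /negln_cst.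
have m0 := mass_gt0 Lphi.
rewrite -ler_ln ?posrE ?mulr_gt0 ?expR_gt0 ?wint_gauss_gt0//.
by rewrite lnM ?posrE ?expR_gt0// expRK; lra.
Qed.

Lemma negln_le x : negln x <= negln_cst + (2 * sqn x + 2 * Lam) / (4 * t).
Proof.
have := wint_gauss_ge x; rewrite neglnE /negln_cst.
have m0 := mass_gt0 Lphi.
rewrite -ler_ln ?posrE ?mulr_gt0 ?expR_gt0 ?wint_gauss_gt0//.
by rewrite lnM ?posrE ?expR_gt0// expRK; lra.
Qed.

(** Moving x to x + s r multiplies the Gaussian by the exponential of an affine function of l(y) =
    r.(x - y), so [tilted_mean] controls the change; p is the mean of l divided by 2t. The loss 2
    Lam / t^2 is the constant 8 times Lam / (2t)^2. *)
Lemma negln_support eta x r : 0 < eta ->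
  exists p, p ^+ 2 <= sqn r * ((1 + eta) * sqn x + (1 + eta^-1) * Lam) / (4 * t ^+ 2) /\
    forall s, negln x + s * p + s ^+ 2 * sqn r * ((4 * t)^-1 - 2 * Lam / t ^+ 2)
      <= negln (x + s *: r).
Proof.
move=> e0; pose l y := dot r (x - y).
have bl : supp_bounded phi l.
  apply: supp_bounded_sum => i.
  under eq_fun do rewrite !mxE.
  apply/supp_boundedZ/supp_boundedD; first exact: supp_bounded_cst.
  exact/supp_boundedN/supp_bounded_coord.
have [e He] := tilted_mean Lphi (supp_bounded_gauss x)
  (fun y => expR_ge0 _) (wint_gauss_gt0 x) bl.
have iv0 : 0 < eta^-1 by rewrite invr_gt0.
pose Q := (1 + eta) * sqn x + (1 + eta^-1) * Lam.
have Q0 : 0 <= Q by rewrite addr_ge0// mulr_ge0 ?sqn_ge0 ?addr_ge0// ltW.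
(* Centre 0 bounds the mean itself, hence p. *)
have [|e1 _] := He 0 (Num.sqrt (sqn r * Q)).
  move=> y /suppLam yL; rewrite subr0 -sqrtr_sqr ler_sqrt ?mulr_ge0 ?sqn_ge0//.
  apply: le_trans (dot_sqr_le _ _) _; rewrite ler_wpM2l ?sqn_ge0// sqnB.
  apply: le_trans (sqdist_le x y e0) _; rewrite lerD2l ler_wpM2l// addr_ge0//.
  exact: ltW.
(* Around r.x the function l deviates only by r.y, so the sub-Gaussian constant does not depend on
   x. *)
have [|_ e2] := He (dot r x) (Num.sqrt (sqn r * Lam)).
  move=> y /suppLam yL; have -> : l y - dot r x = - dot r y.
    rewrite -sumrB -sumrN; apply: eq_bigr => i _; rewrite !mxE; ring.
  rewrite normrN -sqrtr_sqr ler_sqrt ?mulr_ge0 ?sqn_ge0//.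
  by apply: le_trans (dot_sqr_le _ _) _; rewrite ler_wpM2l ?sqn_ge0.
exists (e / (2 * t)); split.
  move: e1; rewrite subr0 -sqrtr_sqr ler_sqrt ?mulr_ge0 ?sqn_ge0// => e1.
  rewrite (_ : _ ^+ 2 = e ^+ 2 / (4 * t ^+ 2)); last by field; rewrite gt_eqF.
  by rewrite ler_pM2r// invr_gt0 mulr_gt0 ?exprn_gt0.
move=> s.
have tilt y : gauss (x + s *: r) y =
    expR (- (s ^+ 2 * sqn r / (4 * t)) - s * (e / (2 * t))) *
    (expR (- (s / (2 * t)) * (l y - e)) * gauss x y).
  rewrite /gauss -!expRD; congr expR.
  have -> : sqdist (x + s *: r) y = sqdist x y + 2 * s * l y + s ^+ 2 * sqn r.
    rewrite !mulr_sumr -!big_split/=; apply: eq_bigr => i _; rewrite !mxE; ring.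
  by field; rewrite gt_eqF.
have bE : supp_bounded phi (fun y => expR (- (s / (2 * t)) * (l y - e)) * gauss x y).
  apply: supp_boundedM (supp_bounded_gauss x).
  by apply/supp_bounded_expR/supp_boundedZ; apply: supp_boundedD => //; exact: supp_bounded_cst.
have := e2 (- (s / (2 * t))).
rewrite exprMn sqr_sqrtr ?mulr_ge0 ?sqn_ge0// => le2.
have le3 : wint phi (gauss (x + s *: r)) <=
    expR (- s * (e / (2 * t)) - s ^+ 2 * sqn r * ((4 * t)^-1 - 2 * Lam / t ^+ 2)) *
    wint phi (gauss x).
  have /funext -> := tilt.
  rewrite (wintZ Lphi)//; apply: le_trans (ler_wpM2l (expR_ge0 _) le2) _.
  rewrite mulrA -expRD le_eqVlt; apply/orP; left; apply/eqP; congr (expR _ * _).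
  by field; rewrite gt_eqF.
have w0 := wint_gauss_gt0.
move: le3; rewrite -ler_ln ?posrE ?mulr_gt0 ?expR_gt0//.
by rewrite lnM ?posrE ?expR_gt0// expRK !neglnE; lra.
Qed.

End heat_bounds.

(** * Reduction to convexity of V^beta, and the case beta > 1/2 *)

(** Positivity of [f] rules out the value -oo of [Psi], so both sides are real and a change of sign
    turns concavity into convexity. *)
Lemma log_concave_posP (R : realType) (n : nat) (beta : R) (f : 'rV[R]_n -> R) :
  (forall x, 0 < f x) ->
  log_concave beta f <->
  (forall x, 0 < - ln (f x)) /\
  forall x y mu, 0 < mu < 1 ->
    (- ln (f ((1 - mu) *: x + mu *: y))) `^ beta <=
    (1 - mu) * (- ln (f x)) `^ beta + mu * (- ln (f y)) `^ beta.
Proof.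
move=> f0.
have f1 x : (f x < 1) = (0 < - ln (f x)) by rewrite oppr_gt0 -ln1 ltr_ln ?posrE.
have PsiE x : Psi beta (f x) = (- ((- ln (f x)) `^ beta))%:E.
  by rewrite /Psi gt_eqF.
have EFin_conv (a b c m : R) : ((1 - m)%R%:E * (- a)%:E + m%:E * (- b)%:E <= (- c)%:E)%E
    = (c <= (1 - m) * a + m * b).
  by rewrite -!EFinM -EFinD lee_fin !mulrN -opprD lerN2.
split=> -[H1 H2]; split.
- by move=> x; rewrite -f1; have /andP[] := H1 x.
- by move=> x y mu hmu; have := H2 x y mu hmu; rewrite !PsiE EFin_conv.
- by move=> x; rewrite (ltW (f0 x)) f1 H1.
- by move=> x y mu hmu; have := H2 x y mu hmu; rewrite !PsiE EFin_conv.
Qed.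

Section concavity.
Variables (R : realType) (n : nat) (phi : 'rV[R]_n -> R).
Hypothesis Lphi : classL phi.
Implicit Types (x y r : 'rV[R]_n) (d t beta : R).

Lemma classL_sqn_support :
  exists Lam, 0 <= Lam /\ forall y, phi y != 0 -> sqn y <= Lam.
Proof.
have [K [K0 HK]] := classL_support Lphi.
exists (\sum_(i < n) K ^+ 2); split; first by apply: sumr_ge0 => i _; exact: sqr_ge0.
move=> y /HK yK; apply: ler_sum => i _.
by rewrite -(real_normK (num_real (y _ _))) ler_sqr ?nnegrE.
Qed.

Lemma log_concaveP beta d t : 0 < t ->
  log_concave beta (fun x => Ud d phi x t) <->
  (forall x, 0 < negln phi d t x) /\
  forall x y mu, 0 < mu < 1 ->
    negln phi d t ((1 - mu) *: x + mu *: y) `^ beta <=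
    (1 - mu) * negln phi d t x `^ beta + mu * negln phi d t y `^ beta.
Proof.
move=> t0; have [Lam [Lam0 suppLam]] := classL_sqn_support.
apply: log_concave_posP => x; exact: (Ud_gt0 d Lphi t0 suppLam).
Qed.

(** A uniform bound V >= delta + ... makes 4 t V gain at least 4 t delta, which for large t absorbs
    all errors that depend only on the support of [phi]. *)
Lemma eventually_log_concave_of_negln_cst beta d (delta T0 : R) : 1 / 2 < beta ->
  0 < delta -> 0 < T0 -> (forall t, T0 <= t -> delta <= negln_cst phi d t) ->
  eventually_log_concave beta d phi.
Proof.
move=> b12 delta0 T00 hdelta; have [Lam [Lam0 suppLam]] := classL_sqn_support.
(* The maximum covers beta > 1, where the product is negative. Since 4 beta (1 - beta) = 1 - (2 beta
   - 1)^2, still 4 th < 1. *)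
pose th := Num.max 0 (beta * (1 - beta)).
have th0 : 0 <= th by rewrite le_max lexx.
have thb : beta * (1 - beta) <= th by rewrite le_max lexx orbT.
have th4 : 4 * th < 1.
  by rewrite /th; case: (leP 0 (beta * (1 - beta))) => _; nra.
(* With 4 th = 1 - 4 eta, the product 4 th (1 + eta) stays below (1 - eta)^2. One factor 1 - eta is
   lost in the lower bound on V, the other in the quadratic coefficient [a]. *)
pose eta := (1 - 4 * th) / 4.
have eta0 : 0 < eta by rewrite /eta; lra.
have eta4 : eta <= 1 / 4 by rewrite /eta; lra.
have etath : 4 * th * (1 + eta) <= (1 - eta) ^+ 2.
  have -> : 4 * th = 1 - 4 * eta by rewrite /eta; lra.
  have := sqr_ge0 eta; lra.
clearbody eta; have iv0 : 0 < eta^-1 by rewrite invr_gt0.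
(* Lam / eta offsets the loss in [negln_ge]. The term (1 + 1/eta) Lam from the bound on p^2 is
   doubled to survive multiplication by 1 - eta >= 1/2, and the final 1 gives V > 0. *)
pose W := Lam / eta + 2 * (1 + eta^-1) * Lam + 1.
have IL : 0 <= (1 + eta^-1) * Lam by rewrite mulr_ge0// addr_ge0// ltW.
have LW : 0 <= Lam / eta by rewrite divr_ge0// ltW.
have W0 : 0 < W by rewrite /W; lra.
(* The three summands ensure, in order, the hypothesis on [negln_cst], a >= (1 - eta) / (4t), and 4
   t delta >= W. *)
exists (T0 + 8 * Lam / eta + W / (4 * delta)).
have LW8 : 0 <= 8 * Lam / eta by rewrite -mulrA; lra.
have WD : 0 < W / (4 * delta) by rewrite divr_gt0// mulr_gt0.
split; first by lra.
move=> t hT; have t0 : 0 < t by lra.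
have hd : delta <= negln_cst phi d t by apply: hdelta; lra.
have hL : 8 * Lam <= eta * t.
  by rewrite (mulrC eta) -ler_pdivrMr//; lra.
have hW : W <= 4 * t * delta.
  by rewrite (mulrC 4) -mulrA -ler_pdivrMr ?mulr_gt0//; lra.
have Vge x : ((1 - eta) * sqn x + (1 + eta^-1) * Lam + 1 + (1 + eta^-1) * Lam) / (4 * t)
    <= negln phi d t x.
  apply: le_trans (negln_ge d Lphi t0 suppLam x eta0).
  rewrite ler_pdivrMr ?mulr_gt0// [leRHS]mulrDl mulfVK ?gt_eqF ?mulr_gt0//.
  have : delta * (4 * t) <= negln_cst phi d t * (4 * t).
    by rewrite ler_wpM2r// mulr_ge0// ltW.
  by rewrite /W in hW; lra.
have Vgt0 x : 0 < negln phi d t x.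
  apply: lt_le_trans (Vge x); rewrite divr_gt0 ?mulr_gt0//.
  have : 0 <= (1 - eta) * sqn x by rewrite mulr_ge0 ?sqn_ge0//; lra.
  lra.
apply/log_concaveP => //; split=> // x y mu /andP[mu0 mu1].
have Vsupp x' r' := negln_support d Lphi t0 Lam0 suppLam x' r' eta0.
move: Vge Vgt0 Vsupp; move: (negln phi d t) => negV Vge Vgt0 Vsupp.
set z := _ + _; pose r := y - x.
have zx : x = z + (- mu) *: r.
  by apply/rowP => i; rewrite !mxE; ring.
have zy : y = z + (1 - mu) *: r.
  by apply/rowP => i; rewrite !mxE; ring.
have [p [p2 Vp]] := Vsupp z r.
have V0 := Vgt0 z; have := Vge z.
set V := negV z in V0 Vp * => Vz.
pose a := (4 * t)^-1 - 2 * Lam / t ^+ 2.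
(* After division by V^2 this is the quadratic term that [powR_support] requires at u = s p / V. *)
have hp : th * p ^+ 2 <= sqn r * a * V.
  apply: (@le_trans _ _ (sqn r * (th * (((1 + eta) * sqn z + (1 + eta^-1) * Lam) /
      (4 * t ^+ 2))))).
    by rewrite (mulrCA (sqn r)) ler_wpM2l// mulrA.
  rewrite -mulrA ler_wpM2l ?sqn_ge0//.
  have ha : (1 - eta) / (4 * t) <= a.
    rewrite (_ : a = (1 - 8 * Lam / t) / (4 * t)); last first.
      by rewrite /a; field; rewrite gt_eqF.
    by rewrite ler_pM2r ?invr_gt0 ?mulr_gt0// lerD2l lerN2 ler_pdivrMr.
  apply: le_trans (ler_wpM2l (le_trans _ ha) Vz); last first.
    by rewrite divr_ge0 ?mulr_ge0 ?(ltW t0)//; lra.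
  set L1 := (1 + eta^-1) * Lam in IL Vz *.
  set N := sqn z in Vz *.
  have N0 : 0 <= N by exact: sqn_ge0.
  have n0 : 0 <= (1 - eta) * N + L1 + 1 + L1.
    by have : 0 <= (1 - eta) * N by [rewrite mulr_ge0//; lra]; lra.
  have t40 : 0 <= (4 * t)^-1 by rewrite invr_ge0 mulr_ge0// ltW.
  apply: le_trans (ler_wpM2r (mulr_ge0 n0 t40) ha).
  rewrite [leLHS](_ : _ = (4 * th * ((1 + eta) * N + L1)) * ((4 * t)^-1 * (4 * t)^-1)).
    rewrite [leRHS](_ : _ = ((1 - eta) * ((1 - eta) * N + L1 + 1 + L1)) *
      ((4 * t)^-1 * (4 * t)^-1)); last by field; rewrite gt_eqF.
    rewrite ler_wpM2r ?mulr_ge0//.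
    have h1 := ler_wpM2r N0 etath; have h2 := ler_wpM2r IL (ltW th4).
    have h3 : 2^-1 * (L1 + 1 + L1) <= (1 - eta) * (L1 + 1 + L1).
      rewrite ler_wpM2r//; [clear -IL; lra|clear -eta4; lra].
    move: h1 h2 h3 th4 th0 N0; clear; lra.
  by field; rewrite gt_eqF.
(* Supporting line of V^beta at z, with slope beta p V^(beta - 1) in the direction r. *)
have support s : V `^ beta + s * (beta * p / V * V `^ beta) <=
    negV (z + s *: r) `^ beta.
  have V'0 := Vgt0 (z + s *: r); have := Vp s; rewrite -/a.
  set V' := negV _ in V'0 * => V'ge.
  have -> : V' = V * (V' / V) by rewrite mulrC mulfVK ?gt_eqF.
  rewrite powRM ?divr_ge0 ?(ltW V0) ?(ltW V'0)//.
  rewrite [leLHS](_ : _ = V `^ beta * (1 + beta * (s * p / V))); last by ring.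
  rewrite ler_pM2l ?powR_gt0//; apply: (powR_support b12 th0 thb).
    by rewrite divr_ge0// ltW.
  rewrite ler_pdivlMr// [leLHS](_ : _ = V + s * p + s ^+ 2 * (th * p ^+ 2) / V).
    apply: le_trans V'ge; rewrite lerD2l ler_pdivrMr//.
    by have := ler_wpM2l (sqr_ge0 s) hp; lra.
  by field; rewrite gt_eqF.
have mu1' : 0 <= 1 - mu by lra.
(* The endpoints x and y sit at s = -mu and s = 1 - mu, so the linear terms cancel in the weighted
   sum. *)
have := lerD (ler_wpM2l mu1' (support (- mu))) (ler_wpM2l (ltW mu0) (support (1 - mu))).
rewrite -zx -zy; apply: le_trans; rewrite le_eqVlt; apply/orP; left; apply/eqP.
by ring.
Qed.

End concavity.

(** * Failure for beta < 1/2 at every positive time *)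

Section nonconcavity.
Variables (R : realType) (n : nat) (phi : 'rV[R]_n -> R).
Hypothesis Lphi : classL phi.
Hypothesis n1 : (1 <= n)%N.

(* A nonnegative convex function bounded above by a multiple of [|x|^(2 beta)] at
   infinity is bounded on each ray when [2 beta < 1]. *)
Lemma not_log_concave (beta d t : R) : 0 < beta -> beta < 1 / 2 -> 0 < t ->
  ~ log_concave beta (fun x => Ud d phi x t).
Proof.
move=> b0 b12 t0 /(log_concaveP Lphi _ _ t0)[V0 Vconv].
have [Lam [Lam0 suppLam]] := classL_sqn_support Lphi.
have Vle := negln_le d Lphi t0 suppLam.
have Vge x := @negln_ge R n phi d t Lam Lphi t0 suppLam 2^-1 x.
move: V0 Vconv Vle Vge; move: (negln phi d t) (negln_cst phi d t) => V k V0 Vconv Vle Vge.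
have t4 : 0 < 4 * t by rewrite mulr_gt0.
pose ray s : 'rV[R]_n := s *: delta_mx 0 (Ordinal n1).
have sqn_ray s : sqn (ray s) = s ^+ 2.
  rewrite /sqn (bigD1 (Ordinal n1))//= big1 => [|i /negPf ni].
    by rewrite !mxE !eqxx mulr1 addr0.
  by rewrite !mxE ni andbF mulr0 expr0n.
pose h s := V (ray s) `^ beta.
have h_le s : h s <= h 0 + 1.
  (* K is chosen so that V at [ray (lam * s)] is at most K lam^2 for every lam >= 1; the summand 2
     makes K > 1. *)
  pose K := `|k| + (2 * s ^+ 2 + 2 * Lam) / (4 * t) + 2.
  have q0 : 0 <= (2 * s ^+ 2 + 2 * Lam) / (4 * t).
    by rewrite divr_ge0 ?(ltW t4)//; have := sqr_ge0 s; lra.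
  have K2 : 2 <= K by rewrite /K; have := normr_ge0 k; lra.
  have bb : 0 < 1 - 2 * beta by lra.
  (* This solves K^beta = lam^(1 - 2 beta), so that (K lam^2)^beta = lam; the exponent is positive
     because beta < 1/2. *)
  pose lam := K `^ (beta / (1 - 2 * beta)).
  have lam1 : 1 < lam.
    have := @gt0_ltr_powR R _ (divr_gt0 b0 bb) 1 K.
    by rewrite !nnegrE powR1; apply; lra.
  have lam0 : 0 < lam by lra.
  have hlam : h (lam * s) <= lam.
    have : V (ray (lam * s)) <= K * lam ^+ 2.
      apply: le_trans (Vle _) _.
      rewrite sqn_ray.
      have l2 : 1 <= lam ^+ 2 by rewrite exprn_ege1// ltW.
      rewrite (_ : K * lam ^+ 2 = (`|k| + 2) * lam ^+ 2 +
          (2 * (lam * s) ^+ 2 + 2 * (Lam * lam ^+ 2)) / (4 * t)); last first.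
        by rewrite /K; field; rewrite gt_eqF.
      apply: lerD.
        apply: le_trans (ler_norm _) _; have := normr_ge0 k.
        by set c := `|_|; nra.
      by rewrite ler_pM2r ?invr_gt0// lerD2l ler_pM2l// ler_peMr.
    move=> /(ge0_ler_powR (ltW b0)) => /(_ _ _) H.
    apply: (le_trans (H _ _)); rewrite ?nnegrE ?(ltW (V0 _))//.
      by rewrite mulr_ge0 ?sqr_ge0//; lra.
    rewrite powRM ?sqr_ge0//; last by lra.
    rewrite -(powR_mulrn 2 (ltW lam0)) -powRrM.
    have -> : K `^ beta = lam `^ (1 - 2 * beta).
      by rewrite /lam -powRrM mulfVK// gt_eqF.
    rewrite -powRD; last by rewrite (gt_eqF lam0) implybT.
    by rewrite subrK powRr1// ltW.
  (* The point [ray s] is the combination of 0 and [ray (lam * s)] with weight 1/lam on the latter,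
     whose contribution is thus at most 1. *)
  have := Vconv (ray 0) (ray (lam * s)) lam^-1.
  rewrite invr_gt0 lam0 invf_lt1// lam1 => /(_ erefl).
  rewrite {1}/ray scale0r scaler0 add0r /ray scalerA mulrA mulVf ?gt_eqF// mul1r.
  rewrite -!/(ray _) -!/(h _) => hs; apply: le_trans hs _; apply: lerD.
    by rewrite ler_piMl ?powR_ge0// gerBl invr_ge0 ltW.
  by rewrite mulrC ler_pdivrMr// mul1r.
pose B := h 0 + 2.
have B0 : 0 <= B by rewrite addr_ge0 ?powR_ge0.
(* Solves (s^2 / 2 - 2 Lam) / (4t) = B^(1/beta) + |k|, the lower bound of [negln_ge] at eta = 1/2,
   so that V^beta reaches B = h 0 + 2. *)
pose s := Num.sqrt (2 * (2 * Lam + 4 * t * (B `^ beta^-1 + `|k|))).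
have Bs : B <= h s.
  have : B `^ beta^-1 <= V (ray s).
    apply: le_trans (Vge (ray s) _) => //.
    rewrite sqn_ray sqr_sqrtr; last first.
      by rewrite mulr_ge0// addr_ge0 ?mulr_ge0 ?addr_ge0 ?powR_ge0// ltW.
    rewrite (_ : _ / (4 * t) = B `^ beta^-1 + `|k|); last first.
      by field; rewrite gt_eqF.
    by have := ler_norm (- k); rewrite normrN; lra.
  move=> /(ge0_ler_powR (ltW b0)) H.
  have := H _ _; rewrite !nnegrE powR_ge0 (ltW (V0 _)) => /(_ erefl erefl).
  by rewrite -powRrM mulVf ?gt_eqF// powRr1.
by have := h_le s; rewrite /B in Bs; lra.
Qed.

End nonconcavity.

(** * A function of mass 1/2, and the four cases together *)

(** Half the indicator of the closed unit cube, whose support is the cube itself. *)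
Lemma classL_box (R : realType) (n : nat) :
  exists phi : 'rV[R]_n -> R, classL phi /\ mass phi = 2^-1.
Proof.
pose B : set (lebesgue_rV_type R n) :=
  [set y : 'rV[R]_n | forall i, `[0 : R, 1]%classic (y ord0 i)].
have mB : measurable B by exact: (measurable_lebesgue_rV (measurable_box 0 1)).
have muB : lebesgue_rV B = 1%E.
  by rewrite /B lebesgue_rV_box// subr0 expr1n.
exists (fun y => 2^-1 * \1_B y).
have phi_neq0 : [set y : 'rV[R]_n | 2^-1 * \1_B y != 0 :> R] = B.
  apply/seteqP; split => y; rewrite /= indicE.
    by case: (boolP (y \in B)) => [/set_mem//|_]; rewrite mulr0 eqxx.
  by move=> yB; rewrite mem_set// mulr1 invr_eq0.
split; [split|].
- by apply: measurable_funM => //; exact: measurable_indic.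
- by move=> y; rewrite mulr_ge0.
- exists 1; split; first exact: num_real.
  move=> c c1 y _ /=; apply: le_trans (ltW c1).
  by rewrite indicE normrM ger0_norm// ger0_norm//; case: (_ \in _) => /=; lra.
- rewrite phi_neq0.
  have cB : compact (B : set 'rV[R]_n).
    exact: (@rV_compact R n (fun=> `[0 : R, 1]%classic) (fun=> @segment_compact _ 0 1)).
  have /closure_id <- : closed (B : set 'rV[R]_n) by exact: compact_closed.
  exact: cB.
- move=> [N [mN N0 BN]].
  have BsubN : B `<=` N.
    by move=> y yB; apply: BN => /= /eqP; apply/negP; rewrite -phi_neq0 in yB.
  have : (lebesgue_rV B <= lebesgue_rV N)%E by apply: le_measure => //; rewrite inE.
  by rewrite N0 muB lee_fin ler10.
- have iB : (\int[@lebesgue_rV R n]_(y in [set: lebesgue_rV_type R n])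
      (\1_B y)%:E = 1)%E by rewrite integral_indic// setIT.
  rewrite /mass RintegralZl//; first by rewrite /Rintegral iB/= mulr1.
  apply/integrableP; split; first exact/measurable_EFinP/measurable_indic.
  under eq_integral do rewrite gee0_abs ?lee_fin//.
  by rewrite iB ltry.
Qed.

Unset Implicit Arguments.
Set Strict Implicit.
Set Printing Implicit Defensive.

Theorem corollary1p1 (R : realType) (n : nat) (hn : (1 <= n)%N)
    (beta : R) (hbeta : 0 < beta) :
  (forall d : R, d < n%:R / 2 ->
     (1 / 2 < beta -> forall phi : 'rV[R]_n -> R, classL phi ->
        eventually_log_concave beta d phi) /\
     (beta < 1 / 2 -> forall phi : 'rV[R]_n -> R, classL phi ->
        ~ eventually_log_concave beta d phi)) /\
  (forall d : R, d = n%:R / 2 ->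
     (1 / 2 < beta -> forall phi : 'rV[R]_n -> R, classL phi -> mass phi < 1 ->
        eventually_log_concave beta d phi) /\
     (beta < 1 / 2 -> exists phi : 'rV[R]_n -> R,
        [/\ classL phi, mass phi < 1 & ~ eventually_log_concave beta d phi])).
Proof.
have not_eventually (d : R) (phi : 'rV[R]_n -> R) : classL phi -> beta < 1 / 2 ->
    ~ eventually_log_concave beta d phi.
  move=> Lphi b12 [T [T0 /(_ T (lexx T))]]; exact: not_log_concave.
split=> d hd; split=> b12.
- move=> phi Lphi; have c0 : 0 < n%:R / 2 - d by rewrite subr_gt0.
  (* For d < n/2 the constant grows like (n/2 - d) ln t. The chosen time solves (n/2 - d) ln t - ln
     M = 1, with M the mass, and the factor 4 pi >= 1 only helps. *)
  apply: (@eventually_log_concave_of_negln_cst _ _ _ Lphi _ _ 1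
    (expR ((1 + ln (mass phi)) / (n%:R / 2 - d)))) => //; first exact: expR_gt0.
  move=> t ht; have t0 : 0 < t := lt_le_trans (expR_gt0 _) ht.
  suff : (1 + ln (mass phi)) <= (n%:R / 2 - d) * ln (4 * pi * t).
    by rewrite /negln_cst; lra.
  rewrite -ler_pdivrMl// mulrC -[leLHS]expRK ler_ln ?posrE ?expR_gt0 ?(fourpit_gt0 t0)//.
  by apply: le_trans ht _; rewrite ler_peMl ?(ltW t0)//; have := pi_ge2 R; lra.
- by move=> phi Lphi; exact: not_eventually.
(* For d = n/2 the logarithm of t drops out and the constant is -ln M, positive exactly because M <
   1. *)
- move=> phi Lphi m1; apply: (@eventually_log_concave_of_negln_cst _ _ _ Lphi _ _
    (- ln (mass phi)) 1) => //.
    by rewrite oppr_gt0 ln_lt0// mass_gt0.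
  by move=> t _; rewrite /negln_cst hd subrr mul0r add0r.
- have [phi [Lphi mphi]] := @classL_box R n.
  exists phi; split=> //; last exact: not_eventually.
  by rewrite mphi; lra.
Qed.
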